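(* Let $A$ be a nonempty subset of $\mathbb{R}^m$ and let $\Phi:A\rightrightarrows\mathbb{R}^n$ be a set-valued mapping with closed graph. Assume that $\operatorname{dom}\Phi$ is non-closed. Then $\Phi(A)$ is unbounded. Moreover, if additionally $(\operatorname{ri}A)\cap\operatorname{dom}\Phi$ is dense in $\operatorname{dom}\Phi$, then $\Phi(\operatorname{ri}A)$ is unbounded.
   Context: A set-valued mapping $\Phi:A\rightrightarrows\mathbb{R}^n$ assigns to each $a\in A$ a (possibly empty) subset $\Phi(a)\subseteq\mathbb{R}^n$. Its domain is $\operatorname{dom}\Phi=\{a\in A:\Phi(a)\neq\emptyset\}\subseteq\mathbb{R}^m$. For $U\subseteq A$, $\Phi(U)=\bigcup_{a\in U}\Phi(a)$. The mapping has closed graph if $\operatorname{gph}\Phi=\{(a,x)\in A\times\mathbb{R}^n: x\in\Phi(a)\}$ is a closed subset of $A\times\mathbb{R}^n$. $\operatorname{ri}A$ denotes the relative interior of $A$.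
   Formalization: ''dom Φ is non-closed'' is taken to mean not closed relative to A; with non-closed in R^m the claim fails, e.g. A = ]0,1[ and Φ ≡ {0}. The two readings agree when A is closed. *)

(* Defs.v *)
From mathcomp Require Import all_boot all_order all_algebra.
From mathcomp Require Import all_classical all_reals all_analysis.

Set Implicit Arguments.
Unset Strict Implicit.
Unset Printing Implicit Defensive.

Import Order.TTheory GRing.Theory Num.Theory numFieldNormedType.Exports.

Local Open Scope classical_set_scope.
Local Open Scope ring_scope.

(* 'rV[R]_m carries the sup norm of the library; in finite dimension it induces
   the same topology and the same bounded sets as the Euclidean norm. *)

Section RelativeInterior.
Context {R : realType} {m : nat}.

Definition affine_hull (A : set 'rV[R]_m) : set 'rV[R]_m :=
  [set x | exists (k : nat) (a : 'I_k -> 'rV[R]_m) (l : 'I_k -> R),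
    [/\ forall i, A (a i), \sum_(i < k) l i = 1
      & x = \sum_(i < k) l i *: a i]].

(* In [subspace B] the points outside B are isolated; this does not matter here,
   since A is included in its affine hull. *)
Definition relative_interior (A : set 'rV[R]_m) : set 'rV[R]_m :=
  (A : set (subspace (affine_hull A)))°.

End RelativeInterior.

(* D is a closed subset of B, for the topology that B inherits from T. *)
Definition closed_in {T : topologicalType} (B D : set T) : Prop :=
  D `<=` B /\ closed (D : set (subspace B)).

(* A set-valued mapping from A to R^n is represented by a function Phi on the
   whole of R^m whose values outside A are irrelevant: the graph and the domain
   only look at points of A, and images are only taken of subsets of A. *)
Section SetValuedMapping.
Context {R : realType} {m n : nat}.
Variables (A : set 'rV[R]_m) (Phi : 'rV[R]_m -> set 'rV[R]_n).

Definition sv_graph : set ('rV[R]_m * 'rV[R]_n) :=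
  [set p | A p.1 /\ Phi p.1 p.2].

Definition sv_dom : set 'rV[R]_m := [set a | A a /\ Phi a !=set0].

Definition sv_image (U : set 'rV[R]_m) : set 'rV[R]_n :=
  \bigcup_(a in U) Phi a.

Definition has_closed_graph : Prop := closed_in (A `*` setT) sv_graph.

End SetValuedMapping.

(* S is dense in D, for the topology that D inherits from T. *)
Definition dense_in {T : topologicalType} (S D : set T) : Prop :=
  S `<=` D /\ D `<=` closure S.

(* Main.v *)
Require Import Defs.
From mathcomp Require Import all_boot all_order all_algebra.
From mathcomp Require Import all_classical all_reals all_analysis.
Import Order.TTheory GRing.Theory Num.Theory numFieldNormedType.Exports.
Local Open Scope classical_set_scope.
Local Open Scope ring_scope.

(** Suppose that [Phi] has bounded image on a subset [S] of [A] such that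
    [S `&` sv_dom A Phi] is dense in [sv_dom A Phi].  A point [a] of [A] that is
    adherent to the domain is then adherent to [S `&` sv_dom A Phi], so it is
    approached by points [s] of [S] carrying values [f s] in [Phi s].  All these
    values lie in one compact set (Heine-Borel), so they cluster at some [y];
    closedness of the graph forces [y] to be in [Phi a], and [a] is in the
    domain.  Hence the domain is closed in [A].  The contrapositive, with
    [S := A] and with [S := relative_interior A], is the theorem.  The cluster
    point argument is purely topological ([closed_graph_fiber_nonempty]). *)

(** The convergent subsequence of the usual argument becomes a cluster point
    [y] in [K] of a selection [f], pushed forward along the neighbourhoods of [a]
    within [S].  Then [(a, y)] is adherent to the graph of [f] over [S], hence
    lies in any closed set [V] of the product that cuts out [G] over [A]; it
    lies in [G] itself because [a] is in [A]. *)
Lemma closed_graph_fiber_nonempty {X Y : topologicalType} {A S : set X}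
    {G : set (X * Y)} {K : set Y} {a : X} :
  closed_in (A `*` setT) G -> compact K ->
  (forall s, S s -> exists2 y, K y & G (s, y)) ->
  A a -> closure S a -> exists y, G (a, y).
Proof.
move=> [GA /closed_subspaceP[V clV VG]] cK selK Aa clSa.
(* A value for the selection outside S; closure S a makes S, hence Y, nonempty. *)
have [y0 _] : exists y0 : Y, True.
  have [s [Ss _]] := clSa _ filterT.
  by have [y _ _] := selK s Ss; exists y.
have /choice[f fP] s : exists y, S s -> K y /\ G (s, y).
  have [/selK[y Ky Gy]|nSs] := pselect (S s); first by exists y.
  by exists y0.
have PF := within_nbhs_proper clSa.
have FK : (f @ within S (nbhs a)) K.
  by apply: (@filterE _ (nbhs a)) => s /fP[].
have [y [_ cly]] := cK _ _ FK.
exists y.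
suff Vay : V (a, y) by have : (G `&` (A `*` setT)) (a, y); [rewrite -VG|case].
apply: clV => B [[B1 B2] /= [aB1 yB2] B12].
have FB1 : (f @ within S (nbhs a)) (f @` (S `&` B1)).
  by apply: (@filterS _ (nbhs a)) aB1 => s B1s Ss; exists s.
have [_ [[s [Ss B1s] <-] B2fs]] := cly _ _ FB1 yB2.
exists (s, f s); split; last exact: B12.
have [_ Gs] := fP s Ss.
have : (V `&` (A `*` setT)) (s, f s).
  by rewrite VG; split=> //; exact: GA.
by case.
Qed.

Lemma bounded_set_sub_compact (R : realType) (n : nat) (B : set 'rV[R]_n) :
  bounded_set B -> exists2 K, compact K & B `<=` K.
Proof.
move=> [M [_ BM]]; exists (closed_ball_ Num.norm 0 (M + 1)).
  apply: bounded_closed_compact; last exact: closed_closed_ball_.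
  exists (M + 1); split; first exact: num_real.
  move=> N /ltW MN x; rewrite /closed_ball_ /= sub0r normrN => xM.
  exact: le_trans xM MN.
move=> x Bx; rewrite /closed_ball_ /= sub0r normrN.
by apply: BM Bx; rewrite ltrDl.
Qed.

(** The part of the domain inside [S] is enough to reach every adherent point
    of the whole domain, since the two have the same closure; so a bound on the
    values over [S] alone suffices. *)
Lemma bounded_image_closed_dom {R : realType} {m n : nat}
    {A S : set 'rV[R]_m} {Phi : 'rV[R]_m -> set 'rV[R]_n} :
  has_closed_graph A Phi -> dense_in (S `&` sv_dom A Phi) (sv_dom A Phi) ->
  bounded_set (sv_image Phi S) -> closed_in A (sv_dom A Phi).
Proof.
move=> Gcl [_ Sdense] /bounded_set_sub_compact[K cK imK].
split=> [a []//|]; apply/closed_subspaceP.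
exists (closure (sv_dom A Phi)); first exact: closed_closure.
apply/seteqP; split=> a [doma Aa]; split=> //; last exact: subset_closure.
have clSa : closure (S `&` sv_dom A Phi) a.
  have /closure_id -> := @closed_closure _ (S `&` sv_dom A Phi).
  exact: closureS doma.
have selK s : (S `&` sv_dom A Phi) s -> exists2 y, K y & sv_graph A Phi (s, y).
  by move=> [Ss [As [y Phisy]]]; exists y => //; apply: imK; exists s.
have [y [_ Phiay]] := closed_graph_fiber_nonempty Gcl cK selK Aa clSa.
by split=> //; exists y.
Qed.

(* "Non-closed" is relative to A, the set on which Phi is defined.  For
   closedness in the whole space the claim fails: take A = ]0, 1[ and
   Phi constantly equal to {0}. *)
Theorem theorem3p1 (R : realType) (m n : nat)
    (A : set 'rV[R]_m) (Phi : 'rV[R]_m -> set 'rV[R]_n)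
    (A_nonempty : A !=set0)
    (Phi_closed : has_closed_graph A Phi)
    (dom_nonclosed : ~ closed_in A (sv_dom A Phi)) :
  ~ bounded_set (sv_image Phi A) /\
  (dense_in (relative_interior A `&` sv_dom A Phi) (sv_dom A Phi) ->
   ~ bounded_set (sv_image Phi (relative_interior A))).
Proof.
have unbounded S : dense_in (S `&` sv_dom A Phi) (sv_dom A Phi) ->
    ~ bounded_set (sv_image Phi S).
  by move=> Sdense /(bounded_image_closed_dom Phi_closed Sdense).
split; last exact: unbounded.
apply: unbounded; split=> [a []//|a doma].
by apply: subset_closure; split=> //; case: doma.
Qed.
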